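(* Let $q$ be a prime power, $s\geq3$, and let $\mathbf{c}=(c_1,\dots,c_s)\in\mathbb{F}_q[t]^s$ with all $c_i\neq0$ and $c_1+\cdots+c_s=0$, so that the equation $c_1x_1+\cdots+c_sx_s=0$ has genus $m\geq1$; let $\ell=\max_i\deg c_i$. Then there exists a constant $C>0$, depending only on $s$, $q$ and $\ell$, such that for every positive integer $N$ and every $A\subset G_N$ with density $\alpha=|A|/|G_N|$ satisfying $0<\alpha<e^{-2}$, \[\Lambda(A)\geq\exp\big(-C\alpha^{-1/(s-2)}(\log(1/\alpha))^4\big).\]
   Context: $G_N$ is the set of polynomials in $\mathbb{F}_q[t]$ of degree strictly less than $N$. $\Lambda(A)$ is defined by: $\Lambda(A)\,|G_N|^{s-1}$ equals the number of tuples $(x_1,\dots,x_s)\in A^s$ with $c_1x_1+\cdots+c_sx_s=0$ in $\mathbb{F}_q[t]$ (trivial solutions included). The genus of the equation is the largest $m$ such that $\{1,\dots,s\}$ can be partitioned into $m$ nonempty sets $T_j$ with $\sum_{i\in T_j}c_i=0$. *)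

(* Defs.v *)
From HB Require Import structures.
From mathcomp Require Import all_boot all_order all_algebra.
From mathcomp Require Import all_classical all_reals all_analysis.

Set Implicit Arguments.
Unset Strict Implicit.
Unset Printing Implicit Defensive.

Import Order.TTheory GRing.Theory Num.Theory.

Local Open Scope ring_scope.

Definition prime_power (q : nat) : Prop :=
  exists p k : nat, [/\ prime p, (0 < k)%N & q = (p ^ k)%N].

(* Meaningful when every [c i] is nonzero: [(size 0).-1 = 0]. *)
Definition max_degree (F : fieldType) (s : nat) (c : 'I_s -> {poly F}) : nat :=
  (\max_(i < s) (size (c i)).-1)%N.

Definition zero_sum_partition (F : fieldType) (s : nat)
    (c : 'I_s -> {poly F}) (P : {set {set 'I_s}}) : bool :=
  finset.partition P [set: 'I_s] && [forall T in P, \sum_(i in T) c i == 0].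

(* By convention 0 when there is no zero-sum partition. *)
Definition genus (F : fieldType) (s : nat) (c : 'I_s -> {poly F}) : nat :=
  (\max_(P : {set {set 'I_s}} | zero_sum_partition c P) #|P|)%N.

(* The set of polynomials of degree < N is the finite type {poly_N F}. *)
Definition density (R : realType) (F : finFieldType) (N : nat)
    (A : {set {poly_N F}}) : R :=
  #|A|%:R / #|[set: {poly_N F}]|%:R.

Definition solutions (F : finFieldType) (s N : nat) (c : 'I_s -> {poly F})
    (A : {set {poly_N F}}) : {set {ffun 'I_s -> {poly_N F}}} :=
  [set x : {ffun 'I_s -> {poly_N F}} |
    [forall i, x i \in A] && (\sum_(i < s) c i * (x i : {poly F}) == 0)].

Definition Lambda (R : realType) (F : finFieldType) (s N : nat)
    (c : 'I_s -> {poly F}) (A : {set {poly_N F}}) : R :=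
  #|solutions c A|%:R / #|[set: {poly_N F}]|%:R ^+ s.-1.

(* Main.v *)
Require Import Defs.
From HB Require Import structures.
From mathcomp Require Import all_boot all_order all_algebra.
From mathcomp Require Import finfield.
From mathcomp Require Import all_classical all_reals all_analysis.
From mathcomp Require Import ring lra zify.
Import Order.TTheory GRing.Theory Num.Theory.
Local Open Scope ring_scope.

Set Implicit Arguments.
Unset Strict Implicit.

(** The number of solutions satisfies the stronger bound
    [Lambda(A) >= kappa * alpha ^ K], with [kappa] and [K] depending only on
    [s], [q] and [l].

    For [a x + b y + c z = 0], multiplication by a fixed polynomial is
    [F_q]-linear, so the indicator of the solution set in [G_M] is a polynomial
    of degree at most [(q - 1) (M + l)] in the coefficients of [x], [y], [z].
    The slice rank method shows that a subset of [G_M] without nontrivial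
    solution has density at most [C rho ^ M] with [rho < 1].  Averaging over the
    progressions [{r + d y : y in G_M}], with [M] of order [log (1 / alpha)],
    turns this into a power lower bound for the number of solutions in [A].

    For more variables, if [c_1 + c_2 != 0] then the substitution
    [x_1 = z + u], [x_2 = z + v] with [c_1 u + c_2 v = 0] merges two variables,
    at the cost of replacing [A] by [A] intersected with two of its translates;
    the three-variable case says that these intersections are large on average.
    If no two coefficients have nonzero sum, a similar substitution in
    opposite variables removes two variables at once. *)

(** * Slice rank of a diagonal tensor *)

(** A basis of the left kernel has [n - \rank U] rows, hence as many independent columns. These form
    an invertible square minor, so some combination of the basis rows equals 1 on all of these
    columns. *)
Lemma kernel_vector_support (F : fieldType) (m n : nat) (U : 'M[F]_(n, m)) :
  exists (h : 'rV[F]_n) (f : 'I_(n - \rank U)%N -> 'I_n),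
    [/\ h *m U = 0, injective f & forall i, h 0 (f i) = 1].
Proof.
pose K := kermx U.
have rK : \rank K = (n - \rank U)%N by rewrite mxrank_ker.
rewrite -rK.
pose Bs := row_base K.
have full : row_full Bs^T by rewrite /row_full mxrank_tr; exact: (row_base_free K).
have := fullrowsub_unit full.
set X := mxsub _ _ _ => uX.
pose w := (invmx X *m const_mx (1 : F) : 'cV_(\rank K))^T.
exists (w *m Bs), (fullrankfun full); split.
- rewrite -mulmxA; have /submxP [D ->] : (Bs <= K)%MS by rewrite eq_row_base.
  by rewrite -mulmxA mulmx_ker !mulmx0.
- exact: fullrankfun_inj.
have Xw : X *m w^T = const_mx 1 by rewrite trmxK mulmxA mulmxV // mul1mx.
move=> i; have <- : (X *m w^T) i 0 = 1 by rewrite Xw mxE.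
rewrite mxE [RHS]mxE; apply: eq_bigr => j _.
by rewrite mulrC [X i j]mxE [w^T j 0]mxE [Bs^T _ _]mxE.
Qed.

(* Tao's slice rank lemma: contracting the last variable with a vector orthogonal
   to all [u2 e] leaves a diagonal matrix of rank at least [n - #|S|], which is
   a sum of [2 * #|S|] matrices of rank one. *)
Lemma slice_rank_diagonal (F : fieldType) (n : nat) (E : finType)
    (S : {set E}) (u0 u1 u2 : E -> 'I_n -> F)
    (G0 G1 G2 : E -> 'I_n -> 'I_n -> F) :
  (forall x y z : 'I_n, ((x == y) && (y == z))%:R =
     \sum_(e in S) u0 e x * G0 e y z + \sum_(e in S) u1 e y * G1 e x z
     + \sum_(e in S) u2 e z * G2 e x y) ->
  (n <= 3 * #|S|)%N.
Proof.
move=> tensorE; set m := #|S|.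
pose U := \matrix_(z < n, i < m) u2 (enum_val i) z.
have [h [f [hU f_inj hf]]] := kernel_vector_support U.
have orth e : e \in S -> \sum_z h 0 z * u2 e z = 0.
  move=> eS; have /matrixP /(_ 0 (enum_rank_in eS e)) := hU.
  rewrite !mxE => {2}<-; apply: eq_bigr => z _.
  by rewrite mxE enum_rankK_in.
(* Contracting [z] with [h] kills the third sum by [orth]. Each of the other two becomes a product
   of an n by m and an m by n matrix. *)
pose P0 := \matrix_(x < n, i < m) u0 (enum_val i) x.
pose Q0 := \matrix_(i < m, y < n) \sum_z h 0 z * G0 (enum_val i) y z.
pose P1 := \matrix_(x < n, i < m) \sum_z h 0 z * G1 (enum_val i) x z.
pose Q1 := \matrix_(i < m, y < n) u1 (enum_val i) y.
have diagE : diag_mx h = P0 *m Q0 + P1 *m Q1.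
  apply/matrixP => x y; rewrite !mxE.
  transitivity (\sum_z h 0 z * ((x == y) && (y == z))%:R).
    rewrite (bigD1 y) //= eqxx andbT big1 ?addr0 => [|z /negbTE].
      by rewrite mulr_natr; have [->|] := eqVneq x y.
    by rewrite eq_sym => ->; rewrite andbF mulr0.
  under eq_bigr => z _ do rewrite tensorE !mulrDr !mulr_sumr.
  rewrite !big_split /= [X in _ + X]exchange_big /= [X in _ + X]big1 ?addr0.
    rewrite exchange_big /= [X in _ + X = _]exchange_big /=.
    congr (_ + _); rewrite big_enum_val; apply: eq_bigr => i _; rewrite !mxE.
      by rewrite mulr_sumr; apply: eq_bigr => z _; rewrite mulrCA.
    by rewrite mulr_suml; apply: eq_bigr => z _; rewrite mulrA mulrAC.
  move=> e eS; under eq_bigr => z _ do rewrite mulrA.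
  by rewrite -mulr_suml orth // mul0r.
have rank_le : (\rank (diag_mx h) <= m + m)%N.
  rewrite diagE (leq_trans (mxrank_add _ _)) // leq_add //.
    by rewrite (leq_trans (mxrankM_maxl _ _)) // rank_leq_col.
  by rewrite (leq_trans (mxrankM_maxl _ _)) // rank_leq_col.
have rank_ge : (n - \rank U <= \rank (diag_mx h))%N.
  rewrite -{1}[(n - _)%N](mxrank1 F).
  (* [Pf] selects the coordinates in the image of [f], where [h] equals 1; the corresponding minor
     of [diag_mx h] is the identity. *)
  pose Pf : 'M[F]_(n - \rank U, n) := \matrix_(i, j) (f i == j)%:R.
  suff -> : 1%:M = Pf *m diag_mx h *m Pf^T.
    by rewrite (leq_trans (mxrankM_maxl _ _)) // mxrankM_maxr.
  apply/matrixP => i j; rewrite !mxE (bigD1 (f j)) //= big1 ?addr0.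
    rewrite !mxE eqxx mulr1 (bigD1 (f j)) //= big1 ?addr0 => [|z /negbTE zf].
      by rewrite !mxE eqxx mulr1n hf mulr1 (inj_eq f_inj).
    by rewrite !mxE zf mulr0n mulr0.
  by move=> z /negbTE; rewrite eq_sym !mxE => ->; rewrite mulr0.
have := rank_leq_col U; lia.
Qed.

(** * Degree of functions on a finite vector space *)

(* Exponents are at most [#|F| - 1], because [x ^+ #|F| = x] on [F]. *)
Notation exponent F I := {ffun I -> 'I_#|F|}.

Definition monomial (F : finFieldType) (I : finType) (e : exponent F I)
    (v : I -> F) : F := \prod_i v i ^+ e i.

Definition weight (F : finFieldType) (I : finType) (e : exponent F I) : nat :=
  (\sum_i e i)%N.

(** Degree is attached to functions, not to formal polynomials: only values matter, and reduced
    exponents keep the number of monomials finite. *)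
Definition has_degree (F : finFieldType) (I : finType) (d : nat)
    (f : (I -> F) -> F) : Prop :=
  exists k : exponent F I -> F,
    (forall e, (d < weight e)%N -> k e = 0) /\
    forall v, f v = \sum_e k e * monomial e v.


Lemma has_degree_ext (F : finFieldType) (I : finType) (d : nat)
    (f g : (I -> F) -> F) : f =1 g -> has_degree d f -> has_degree d g.
Proof. by move=> fg [k [k0 kE]]; exists k; split=> // v; rewrite -fg. Qed.

Lemma has_degree_monomial (F : finFieldType) (I : finType) (d : nat)
    (e : exponent F I) : (weight e <= d)%N -> has_degree d (monomial e).
Proof.
move=> le_ed; exists (fun e' => (e' == e)%:R); split=> [e'|v].
  by have [->|//] := eqVneq e' e; rewrite ltnNge le_ed.
rewrite (bigD1 e) //= eqxx mul1r big1 ?addr0 // => e' /negbTE ->.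
by rewrite mul0r.
Qed.

Lemma has_degree0 (F : finFieldType) (I : finType) (d : nat) :
  has_degree d (fun _ : I -> F => 0).
Proof. by exists (fun=> 0); split=> // v; rewrite big1 // => e _; rewrite mul0r. Qed.

Lemma has_degreeD (F : finFieldType) (I : finType) (d : nat)
    (f g : (I -> F) -> F) : has_degree d f -> has_degree d g ->
  has_degree d (fun v => f v + g v).
Proof.
move=> [k [k0 kE]] [k' [k'0 k'E]]; exists (fun e => k e + k' e); split=> [e de|v].
  by rewrite k0 // k'0 // addr0.
by rewrite kE k'E -big_split; apply: eq_bigr => e _; rewrite mulrDl.
Qed.

Lemma has_degreeZ (F : finFieldType) (I : finType) (d : nat) (a : F)
    (f : (I -> F) -> F) : has_degree d f -> has_degree d (fun v => a * f v).
Proof.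
move=> [k [k0 kE]]; exists (fun e => a * k e); split=> [e de|v].
  by rewrite k0 // mulr0.
by rewrite kE mulr_sumr; apply: eq_bigr => e _; rewrite mulrA.
Qed.

Lemma has_degree_sum (F : finFieldType) (I J : finType) (d : nat)
    (f : J -> (I -> F) -> F) : (forall j, has_degree d (f j)) ->
  has_degree d (fun v => \sum_j f j v).
Proof.
move=> fd; elim: (index_enum J) => [|j r IHr].
  by apply: has_degree_ext (@has_degree0 _ _ _) => v; rewrite big_nil.
by apply: has_degree_ext (has_degreeD (fd j) IHr) => v; rewrite big_cons.
Qed.

Lemma has_degree_const (F : finFieldType) (I : finType) (d : nat) (a : F) :
  has_degree d (fun _ : I -> F => a).
Proof.
have q_gt0 : (0 < #|F|)%N by apply/card_gt0P; exists 0.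
pose e0 : exponent F I := [ffun=> Ordinal q_gt0].
have we0 : weight e0 = 0%N by rewrite /weight big1 // => i _; rewrite ffunE.
have /(has_degreeZ a) : has_degree d (monomial e0).
  by apply: has_degree_monomial; rewrite we0.
apply: has_degree_ext => v; rewrite /monomial big1 ?mulr1 // => i _.
by rewrite ffunE.
Qed.

(** The exponent of [v i] goes up by one, unless it would reach [#|F|]; then [x ^+ #|F| = x] brings
    it back to 1. In both cases the weight grows by at most one. *)
Lemma has_degree_var_monomial (F : finFieldType) (I : finType) (d : nat) (i : I)
    (e : exponent F I) : (weight e <= d)%N ->
  has_degree d.+1 (fun v => v i * monomial e v).
Proof.
move=> le_ed; have q_gt1 : (1 < #|F|)%N by exact: finNzRing_gt1.
pose k := if (e i).+1 == #|F| then 1%N else (e i).+1.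
have k_lt : (k < #|F|)%N.
  by rewrite /k; case: eqP => // neq; rewrite ltn_neqAle ltn_ord andbT; apply/eqP.
pose e' : exponent F I := [ffun j => if j == i then Ordinal k_lt else e j].
have e'E v : v i * monomial e v = monomial e' v.
  rewrite /monomial (bigD1 i) //= [RHS](bigD1 i) //= ffunE eqxx mulrA -exprS.
  congr (_ * _); last by apply: eq_bigr => j /negbTE ji; rewrite ffunE ji.
  by rewrite /= /k; case: eqP => // ->; rewrite expf_card.
apply: has_degree_ext (fun v => esym (e'E v)) _; apply: has_degree_monomial.
apply: leq_trans (_ : (weight e).+1 <= _)%N; last by rewrite ltnS.
rewrite /weight (bigD1 i) //= ffunE eqxx [X in (_ <= X.+1)%N](bigD1 i) //=.
rewrite -addSn leq_add //; first by rewrite /k; case: eqP => // ->.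
by apply: leq_sum => j /negbTE ji; rewrite ffunE ji.
Qed.

Lemma has_degree_var (F : finFieldType) (I : finType) (d : nat) (i : I)
    (f : (I -> F) -> F) : has_degree d f -> has_degree d.+1 (fun v => v i * f v).
Proof.
move=> [k [k0 kE]].
apply: (@has_degree_ext _ _ _
  (fun v => \sum_e k e * (v i * monomial e v))) => [v|].
  by rewrite kE mulr_sumr; apply: eq_bigr => e _; rewrite mulrCA.
apply: has_degree_sum => e; have [le_ed|/k0 ->] := leqP (weight e) d.
  exact/has_degreeZ/has_degree_var_monomial.
by apply: has_degree_ext (@has_degree0 _ _ _) => v; rewrite mul0r.
Qed.

Lemma has_degree_linearM (F : finFieldType) (I : finType) (d n : nat)
    (a : I -> F) (f : (I -> F) -> F) : has_degree d f ->
  has_degree (n + d) (fun v => (\sum_i a i * v i) ^+ n * f v).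
Proof.
move=> fd; elim: n => [|n IHn]; first by apply: has_degree_ext fd => v; rewrite mul1r.
apply: (@has_degree_ext _ _ _ (fun v => \sum_i a i *
    (v i * ((\sum_i a i * v i) ^+ n * f v)))) => [v|].
  by rewrite exprS -mulrA [RHS]mulr_suml; apply: eq_bigr => i _; rewrite mulrA.
by apply: has_degree_sum => i; apply: has_degreeZ; apply: has_degree_var.
Qed.

(* The indicator is the product of the [1 - L_j ^+ (#|F| - 1)]. *)
Lemma has_degree_common_zeros (F : finFieldType) (I : finType) (m : nat)
    (a : 'I_m -> I -> F) :
  has_degree (m * #|F|.-1)
    (fun v => [forall j, \sum_i a j i * v i == 0]%:R).
Proof.
have q_gt1 : (1 < #|F|)%N by exact: finNzRing_gt1.
have zeroE (x : F) : (x == 0)%:R = 1 - x ^+ #|F|.-1 :> F.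
  have [->|x_neq0] := eqVneq x 0.
    by case: #|F| q_gt1 => [|[|n]] // _; rewrite /= exprS mul0r subr0.
  apply/esym/eqP; rewrite subr_eq0 eq_sym -(inj_eq (mulfI x_neq0)) -exprS mulr1.
  by rewrite prednK ?expf_card // ltnW.
suff : has_degree (m * #|F|.-1) (fun v =>
    \prod_(j < m) (1 - (\sum_i a j i * v i) ^+ #|F|.-1)).
  move/has_degree_ext; apply=> v; under eq_bigr => j _ do rewrite -zeroE.
  have [/forallP all0|/forallPn [j /negbTE nz]] :=
      boolP [forall j, \sum_i a j i * v i == 0].
    by rewrite big1 // => j _; rewrite all0.
  by rewrite (bigD1 j) //= nz mul0r.
elim: m a => [|m IHm] a.
  by apply: has_degree_ext (@has_degree_const _ _ _ 1) => v; rewrite big_ord0.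
pose g v := \prod_(j < m) (1 - (\sum_i a (lift ord0 j) i * v i) ^+ #|F|.-1).
have gd : has_degree (m * #|F|.-1) g by exact: IHm.
apply: (@has_degree_ext _ _ _ (fun v =>
    (\sum_i a ord0 i * v i) ^+ 0 * g v +
    -1 * ((\sum_i a ord0 i * v i) ^+ #|F|.-1 * g v))) => [v|].
  by rewrite big_ord_recl /= /g; ring.
rewrite mulSn; apply: has_degreeD.
  case: gd => k [k0 kE]; exists k; split=> [e de|v]; last by rewrite mul1r.
  by apply: k0; apply: leq_ltn_trans de; exact: leq_addl.
exact/has_degreeZ/has_degree_linearM.
Qed.

(** * Sets with only trivial solutions in three variables *)

(** The threshold is a third of [d]: of three exponents with total weight at most [d], one must be
    low. *)
Definition low_exponents (F : finFieldType) (M d : nat) : {set exponent F 'I_M} :=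
  [set e | 3 * weight e <= d]%N.

Lemma npoly_expansion (F : fieldType) (M : nat) (x : {poly_M F}) :
  (x : {poly F}) = \sum_(i < M) x`_i *: 'X^i.
Proof. by rewrite -poly_def; apply/polyP=> i; rewrite coef_poly; case: ltnP => // /big_coef_npoly. Qed.

(** On [B] the indicator of the equation is the diagonal tensor. As a polynomial it has degree at
    most [d], so each of its monomials has a low factor in [x], [y] or [z]; grouping by that factor
    gives a slice decomposition. *)
Lemma card_trivial_solutions (F : finFieldType) (l M : nat) (a b c : {poly F})
    (B : {set {poly_M F}}) :
  (size a <= l.+1)%N -> (size b <= l.+1)%N -> (size c <= l.+1)%N ->
  a + b + c = 0 ->
  (forall x y z : {poly_M F}, x \in B -> y \in B -> z \in B ->
     a * (x : {poly F}) + b * (y : {poly F}) + c * (z : {poly F}) = 0 ->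
     x = y /\ y = z) ->
  (#|B| <= 3 * #|low_exponents F M ((M + l) * #|F|.-1)|)%N.
Proof.
move=> sa sb sc abc0 triv; set d := ((M + l) * _)%N; set S := low_exponents F M d.
pose co (r : 'I_3) := [:: a; b; c]`_r.
(* The linear form giving the coefficient of degree [j] of the left-hand side; [M + l] of them
   suffice by the size bound [sP]. *)
pose A (j : 'I_(M + l)) (p : 'I_3 * 'I_M) := (co p.1 * 'X^(p.2))`_j.
have [k [k0 kE]] := has_degree_common_zeros A.
pose r0 : 'I_3 := ord0; pose r1 : 'I_3 := lift ord0 ord0.
pose r2 : 'I_3 := lift ord0 (lift ord0 ord0).
pose sec (r : 'I_3) (e : exponent F ('I_3 * 'I_M)%type) : exponent F 'I_M :=
  [ffun i => e (r, i)].
pose mon (e : exponent F 'I_M) (x : {poly_M F}) := monomial e (fun i => x`_i).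
have weightE e : weight e = (weight (sec r0 e) + (weight (sec r1 e) + weight (sec r2 e)))%N.
  rewrite /weight; transitivity (\sum_(r < 3) \sum_(i < M) e (r, i))%N.
    by rewrite pair_bigA; apply: eq_bigr => -[].
  rewrite !big_ord_recl big_ord0 addn0.
  by congr (_ + (_ + _))%N; apply: eq_bigr => i _; rewrite ffunE.
pose v (x y z : {poly_M F}) (p : 'I_3 * 'I_M) : F :=
  (nth (0 : {poly F}) [:: x : {poly F}; y : {poly F}; z : {poly F}] p.1)`_(p.2).
have monE e x y z : monomial e (v x y z) =
    mon (sec r0 e) x * (mon (sec r1 e) y * mon (sec r2 e) z).
  rewrite /mon /monomial; transitivity (\prod_(r < 3) \prod_(i < M) v x y z (r, i) ^+ e (r, i)).
    by rewrite pair_bigA; apply: eq_bigr => -[].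
  rewrite !big_ord_recl big_ord0 mulr1.
  by congr (_ * (_ * _)); apply: eq_bigr => i _; rewrite ffunE.
have formE x y z : [forall j, \sum_i A j i * v x y z i == 0] =
    (a * (x : {poly F}) + b * (y : {poly F}) + c * (z : {poly F}) == 0).
  set P := (_ + _ + _).
  have coefP j : P`_(j : 'I_(M + l)) = \sum_i A j i * v x y z i.
    transitivity (\sum_(r < 3) \sum_(i < M) A j (r, i) * v x y z (r, i)); last first.
      by rewrite pair_bigA; apply: eq_bigr => -[].
    rewrite !big_ord_recl big_ord0 addr0 addrA /P !coefD /A /v /=.
    by congr (_ + _ + _); rewrite [in LHS]npoly_expansion mulr_sumr coef_sum;
      apply: eq_bigr => i _; rewrite -scalerAr coefZ mulrC.
  have sP : (size P <= M + l)%N.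
    have szM (p : {poly F}) (w : {poly_M F}) : (size p <= l.+1 -> size (p * w)%R <= M + l)%N.
      by move=> sp; have := size_polyMleq p w; have := size_npoly w; lia.
    rewrite (leq_trans (size_polyD _ _)) // geq_max szM // andbT.
    by rewrite (leq_trans (size_polyD _ _)) // geq_max !szM.
  apply/forallP/eqP => [all0|P0 j]; last by rewrite -coefP P0 coef0.
  apply/polyP => j; rewrite coef0; have [jlt|/(leq_trans sP) jge] := ltnP j (M + l).
    by have /eqP := all0 (Ordinal jlt); rewrite -coefP.
  by rewrite nth_default.
(* Each monomial is assigned to the first of its three factors that is low, so that it is counted
   once. *)
pose p0 e := sec r0 e \in S.
pose p1 e := ~~ p0 e && (sec r1 e \in S).
pose p2 e := [&& ~~ p0 e, sec r1 e \notin S & sec r2 e \in S].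
pose G0 e' y z := \sum_(e | p0 e && (sec r0 e == e')) k e * (mon (sec r1 e) y * mon (sec r2 e) z).
pose G1 e' x z := \sum_(e | p1 e && (sec r1 e == e')) k e * (mon (sec r0 e) x * mon (sec r2 e) z).
pose G2 e' x y := \sum_(e | p2 e && (sec r2 e == e')) k e * (mon (sec r0 e) x * mon (sec r1 e) y).
apply: (@slice_rank_diagonal F #|B| _ S
  (fun e x => mon e (enum_val x)) (fun e x => mon e (enum_val x))
  (fun e x => mon e (enum_val x)) (fun e y z => G0 e (enum_val y) (enum_val z))
  (fun e y z => G1 e (enum_val y) (enum_val z))
  (fun e y z => G2 e (enum_val y) (enum_val z))) => i0 i1 i2.
set x := enum_val i0; set y := enum_val i1; set z := enum_val i2.
transitivity ([forall j, \sum_i A j i * v x y z i == 0]%:R : F).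
  congr (_%:R); rewrite formE; congr (nat_of_bool _).
  rewrite -(inj_eq enum_val_inj) -(inj_eq enum_val_inj) -/x -/y -/z.
  apply/andP/eqP => [[/eqP -> /eqP ->]|]; first by rewrite -!mulrDl abc0 mul0r.
  by case/(triv _ _ _ (enum_valP _) (enum_valP _) (enum_valP _)) => /eqP ? /eqP ?; split.
rewrite kE (bigID p0) /= -addrA; congr (_ + _).
  rewrite (partition_big (sec r0) (mem S)) //=; apply: eq_bigr => e' _.
  rewrite mulr_sumr; apply: eq_bigr => e /andP [_ /eqP <-].
  by rewrite monE mulrCA.
rewrite (bigID (fun e => sec r1 e \in S)) /=; congr (_ + _).
  rewrite (partition_big (sec r1) (mem S)) /= => [|e /andP []//].
  apply: eq_bigr => e' _.
  rewrite mulr_sumr; apply: eq_bigr => e /andP [_ /eqP <-].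
  by rewrite monE; ring.
rewrite (bigID (fun e => sec r2 e \in S)) /= [X in _ + X]big1 ?addr0.
  rewrite (partition_big (sec r2) (mem S)) /= => [|e /andP []//].
  apply: eq_bigr => e' _.
  rewrite mulr_sumr; apply: eq_big => [e|e /andP [_ /eqP <-]].
    by rewrite /p2 !andbA.
  by rewrite monE; ring.
(* With no low factor the three weights add up to more than [d], and the coefficient vanishes. *)
move=> e; rewrite /p0 !inE -!ltnNge => /andP [/andP [h0 h1] h2].
rewrite k0 ?mul0r // weightE -/d; lia.
Qed.

(** * Exponential saving in the number of low exponents *)

(* Chernoff's bound, with the generating function of the weight. *)
Lemma card_low_exponents (R : realFieldType) (F : finFieldType) (M d : nat)
    (y : R) : 0 < y -> y <= 1 ->
  #|low_exponents F M d|%:R * y ^+ d <= (\sum_(j < #|F|) y ^+ (3 * j)) ^+ M.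
Proof.
move=> y_gt0 y_le1; set S := low_exponents F M d.
have -> : (\sum_(j < #|F|) y ^+ (3 * j)) ^+ M
    = \sum_(e : exponent F 'I_M) y ^+ (3 * weight e).
  rewrite -[M in LHS]card_ord -prodr_const.
  rewrite (bigA_distr_bigA (fun (_ : 'I_M) (j : 'I_#|F|) => y ^+ (3 * j))) /=.
  by apply: eq_bigr => e _; rewrite -expr_sum -big_distrr.
rewrite mulr_natl -sumr_const [leRHS](bigID (mem S)) /= ler_wpDr ?sumr_ge0 //.
  by move=> e _; rewrite exprn_ge0 // ltW.
by apply: ler_sum => e; rewrite inE => le_ed; apply: ler_wiXn2l => //; exact: ltW.
Qed.

(** Bernoulli's inequality with a second-order upper companion, used to compare powers of [1 - x] to
    first order for small [x]. *)
Lemma expr_one_minus_bounds (R : realFieldType) (x : R) (n : nat) :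
  0 <= x -> x <= 1 ->
  1 - n%:R * x <= (1 - x) ^+ n <= 1 - n%:R * x + n%:R ^+ 2 * x ^+ 2.
Proof.
move=> x_ge0 x_le1; elim: n => [|n /andP [IHl IHu]].
  by rewrite expr0 mul0r subr0 expr0n mul0r addr0 lexx.
have n_ge0 : 0 <= n%:R :> R by exact: ler0n.
have x1_ge0 : 0 <= 1 - x by rewrite subr_ge0.
have nx_ge0 : 0 <= n%:R * x ^+ 2 by rewrite mulr_ge0 ?exprn_ge0.
have x2_ge0 : 0 <= x ^+ 2 by rewrite exprn_ge0.
have nnx_ge0 : 0 <= n%:R ^+ 2 * x ^+ 3 by rewrite mulr_ge0 ?exprn_ge0.
have := ler_wpM2l x1_ge0 IHl; have := ler_wpM2l x1_ge0 IHu.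
by rewrite -exprS -natr1 => hu hl; apply/andP; split; lra.
Qed.

(* At y = 1 both sides equal q, with derivatives 3q(q-1)/2 and q(q-1); hence
   the inequality holds slightly below 1. *)
Lemma chernoff_base (R : realFieldType) (q : nat) : (1 < q)%N ->
  exists y : R, [/\ 0 < y, y < 1 &
    \sum_(j < q) y ^+ (3 * j) < q%:R * y ^+ q.-1].
Proof.
move=> q_gt1; have q_gt0 : 0 < q%:R :> R by rewrite ltr0n ltnW.
have q_ge2 : 2 <= q%:R :> R by rewrite ler_nat.
(* With this [x], the quadratic error [9 j^2 x^2] is at most [9 j q x^2 = j x / 2], which leaves the
   slope [3 - 1/2 = 5/2] in [term_le]. *)
pose x : R := (18 * q%:R)^-1.
have xq : 18 * q%:R * x = 1 by rewrite divff // mulf_neq0 ?gt_eqF // ltr0n.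
have x_gt0 : 0 < x by rewrite invr_gt0 mulr_gt0 // ltr0n.
have x_lt1 : x < 1 by nra.
exists (1 - x); split; [by rewrite subr_gt0|by rewrite ltrBlDr ltrDl|].
have term_le (j : 'I_q) : (1 - x) ^+ (3 * j) <= 1 - 5 / 2 * j%:R * x.
  have /andP [_] := @expr_one_minus_bounds R x (3 * j) (ltW x_gt0) (ltW x_lt1).
  move/le_trans; apply.
  have jq : j%:R <= q%:R :> R by rewrite ler_nat ltnW.
  have j_ge0 : 0 <= j%:R :> R by exact: ler0n.
  have jxx : 0 <= j%:R * x * x * (q%:R - j%:R) by rewrite !mulr_ge0 ?subr_ge0 // ltW.
  have : j%:R * x * (18 * q%:R * x) = j%:R * x by rewrite xq mulr1.
  by rewrite natrM; lra.
apply: le_lt_trans (ler_sum _ (fun j _ => term_le j)) _.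
have sumE n : \sum_(j < n) (1 - 5 / 2 * j%:R * x)
    = n%:R - 5 / 4 * n%:R * (n%:R - 1) * x.
  elim: n => [|n IHn]; first by rewrite big_ord0; ring.
  by rewrite big_ord_recr IHn /= -natr1; field.
have /andP [low _] := @expr_one_minus_bounds R x q.-1 (ltW x_gt0) (ltW x_lt1).
(* The sum has slope [5/4 q (q - 1)], against [q (q - 1)] for the lower bound of the right-hand
   side. *)
rewrite sumE; apply: lt_le_trans (ler_wpM2l (ltW q_gt0) low).
have -> : q.-1%:R = q%:R - 1 :> R by rewrite -subn1 natrB // ltnW.
have : 0 < q%:R * (q%:R - 1) * x by rewrite !mulr_gt0 // subr_gt0; lra.
by lra.
Qed.

Lemma solution_free_density (R : realFieldType) (q l : nat) : (1 < q)%N ->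
  exists C rho : R, [/\ 1 <= C, 0 < rho, rho < 1 &
    forall (F : finFieldType) (M : nat) (a b c : {poly F}) (B : {set {poly_M F}}),
      #|F| = q ->
      (size a <= l.+1)%N -> (size b <= l.+1)%N -> (size c <= l.+1)%N ->
      a + b + c = 0 ->
      (forall x y z : {poly_M F}, x \in B -> y \in B -> z \in B ->
         a * (x : {poly F}) + b * (y : {poly F}) + c * (z : {poly F}) = 0 ->
         x = y /\ y = z) ->
      #|B|%:R <= C * rho ^+ M * q%:R ^+ M].
Proof.
move=> q_gt1; have [y [y_gt0 y_lt1 hy]] := chernoff_base R q_gt1.
have q_gt0 : 0 < q%:R :> R by rewrite ltr0n ltnW.
pose D := (l * q.-1)%N.
set s := \sum_(j < q) _ in hy.
have s_gt0 : 0 < s.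
  apply: lt_le_trans (_ : y ^+ (3 * 0) <= _); first by rewrite exprn_gt0.
  rewrite /s (bigD1 (Ordinal (ltnW q_gt1))) //= lerDl sumr_ge0 // => i _.
  by rewrite exprn_ge0 // ltW.
have den_gt0 : 0 < q%:R * y ^+ q.-1 by rewrite mulr_gt0 ?exprn_gt0.
(* [C] absorbs the factor 3 of the slice rank bound and the part [D] of the degree due to the
   coefficients; [rho < 1] is the inequality [hy]. *)
exists (3 / y ^+ D), (s / (q%:R * y ^+ q.-1)); split.
- rewrite ler_pdivlMr ?exprn_gt0 // mul1r.
  have : y ^+ D <= 1 by rewrite exprn_ile1 // ltW.
  by lra.
- by rewrite divr_gt0.
- by rewrite ltr_pdivrMr // mul1r.
move=> F M a b c B Fq sa sb sc abc0 triv.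
have := card_trivial_solutions sa sb sc abc0 triv.
rewrite -(ler_nat R) natrM => /le_trans; apply.
have := @card_low_exponents R F M ((M + l) * #|F|.-1) y y_gt0 (ltW y_lt1).
move: #|low_exponents _ _ _|%:R => m.
rewrite Fq -/s mulnDl exprD -/D => le_m.
rewrite expr_div_n exprMn -exprM (mulnC q.-1 M).
have yD : 0 < y ^+ D by rewrite exprn_gt0.
have yM : 0 < y ^+ (M * q.-1) by rewrite exprn_gt0.
have qM : 0 < q%:R ^+ M :> R by rewrite exprn_gt0.
have -> : 3 / y ^+ D * (s ^+ M / (q%:R ^+ M * y ^+ (M * q.-1))) * q%:R ^+ M
    = 3 * (s ^+ M / (y ^+ (M * q.-1) * y ^+ D)).
  by field; rewrite !gt_eqF.
rewrite ler_pM2l ?ltr0n //.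
by rewrite ler_pdivlMr ?mulr_gt0.
Qed.

(** * Averaging over progressions and the three-variable bound *)

Definition solutions3 (F : finFieldType) (N : nat) (a b c : {poly F})
    (A : {set {poly_N F}}) : {set {poly_N F} * {poly_N F} * {poly_N F}} :=
  [set p | [&& p.1.1 \in A, p.1.2 \in A, p.2 \in A &
    a * (p.1.1 : {poly F}) + b * (p.1.2 : {poly F}) + c * (p.2 : {poly F}) == 0]].

(* Varnavides' averaging argument over the progressions {r + d y : y in G_M}. *)
Lemma varnavides (R : realFieldType) (F : finFieldType) (N M : nat)
    (a b c : {poly F}) (A : {set {poly_N F}}) (theta : R) :
  (M <= N)%N -> c != 0 -> a + b + c = 0 ->
  (forall B : {set {poly_M F}},
     (forall x y z : {poly_M F}, x \in B -> y \in B -> z \in B ->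
       a * (x : {poly F}) + b * (y : {poly F}) + c * (z : {poly F}) = 0 ->
       x = y /\ y = z) ->
     #|B|%:R <= theta * #|F|%:R ^+ M) ->
  2 * theta * #|F|%:R ^+ N <= #|A|%:R ->
  #|F|%:R ^+ (N - M) * #|A|%:R
    <= 2 * #|solutions3 a b c A|%:R * #|F|%:R ^+ (2 * M) :> R.
Proof.
move=> MN c_neq0 abc0 freeB thetaA.
pose q := #|F|; have q_gt1 : (1 < q)%N by exact: finNzRing_gt1.
(* Differences have degree at most [N - M], hence the type with [(N - M).+1]; then [d * y] has
   degree below [N] and no truncation occurs. *)
pose t (d : {poly_(N - M).+1 F}) (y : {poly_M F}) : {poly_N F} :=
  npolyp N ((d : {poly F}) * (y : {poly F})).
have tE d y : (t d y : {poly F}) = (d : {poly F}) * (y : {poly F}).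
  apply: npolypK; have := size_polyMleq (d : {poly F}) (y : {poly F}).
  by have := size_npoly d; have := size_npoly y; lia.
pose eqn (p : {poly_M F} * {poly_M F} * {poly_M F}) :=
  a * (p.1.1 : {poly F}) + b * (p.1.2 : {poly F}) + c * (p.2 : {poly F}) == 0.
pose B d (r : {poly_N F}) := [set y | r + t d y \in A].
(* Requiring the first two entries to differ captures all nontrivial solutions: if they agree, the
   equation becomes [c (z - y) = 0]. *)
pose good d r (p : {poly_M F} * {poly_M F} * {poly_M F}) :=
  [&& p.1.1 \in B d r, p.1.2 \in B d r, p.2 \in B d r, p.1.1 != p.1.2 & eqn p].
pose W := [set u : {poly_(N - M).+1 F} * {poly_N F} |
  (u.1 != 0) && [exists p, good u.1 u.2 p]].
have indicator d r : #|B d r|%:R <=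
    [exists p, good d r p]%:R * q%:R ^+ M + theta * q%:R ^+ M.
  have [ex|/existsPn none] := boolP [exists p, good d r p].
    have card_le : #|B d r|%:R <= q%:R ^+ M :> R.
      by rewrite -natrX ler_nat -card_npoly max_card.
    have theta_ge0 : 0 <= theta * q%:R ^+ M.
      apply: le_trans (freeB finset.set0 _) => [|x y z]; first by rewrite cards0.
      by rewrite inE.
    by rewrite mul1r ler_wpDr.
  rewrite mul0r add0r; apply: freeB => x y z xB yB zB xyz0.
  have xy : x = y.
    apply/eqP; have := none (x, y, z); rewrite /good /eqn /= xB yB zB xyz0 eqxx.
    by rewrite andbT negbK.
  split=> //; move: xyz0; rewrite xy -mulrDl => xyz0.
  have : c * ((z : {poly F}) - (y : {poly F})) = 0.
    have cE : c = - (a + b) by apply/eqP; rewrite -addr_eq0 addrC abc0.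
    by rewrite mulrBr {2}cE mulNr opprK addrC.
  by move/eqP; rewrite mulf_eq0 (negbTE c_neq0) subr_eq0 => /eqP /val_inj.
have sumB d : (\sum_r #|B d r| = q ^ M * #|A|)%N.
  transitivity (\sum_r \sum_(y | (r + t d y)%R \in A) 1)%N.
    by apply: eq_bigr => r _; rewrite -sum1_card; apply: eq_bigl => y; rewrite inE.
  rewrite (exchange_big_dep predT) //= -card_npoly -sum_nat_const.
  apply: eq_bigr => y _; rewrite -sum1_card [RHS](reindex_inj (addIr (t d y))).
  by [].
(* The sets [B d r] have total size [q^M |A|] over [r]. By [thetaA] the [theta] terms take at most
   half of it, so at least [|A| / 2] shifts are good. *)
have goodr d : #|A|%:R <= 2 * (\sum_r [exists p, good d r p])%N%:R :> R.
  have qM_gt0 : 0 < q%:R ^+ M :> R by rewrite exprn_gt0 // ltr0n ltnW.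
  have /(ler_sum _) := fun r (_ : true) => indicator d r.
  move/(_ (index_enum _)).
  rewrite -natr_sum sumB big_split /= -mulr_suml -natr_sum sumr_const.
  rewrite card_npoly -[_ *+ (_ ^ N)]mulr_natl natrM !natrX -/q => h.
  set g := (X in 2 * X); rewrite -(ler_pM2l qM_gt0).
  have := ler_wpM2l (ltW qM_gt0) thetaA; rewrite -/q -/g in h *; lra.
have cardW : #|F|%:R ^+ (N - M) * #|A|%:R <= 2 * #|W|%:R :> R.
  have -> : #|W| = (\sum_(d : {poly_(N - M).+1 F} | d != 0%R) \sum_r [exists p, good d r p])%N.
    rewrite -sum1_card pair_big_dep /= big_mkcond [RHS]big_mkcond /=.
    by apply: eq_bigr => -[d r] _; rewrite inE /= andbT; case: (d != 0); case: [exists p, _].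
  have -> : 2 * (\sum_(d : {poly_(N - M).+1 F} | d != 0%R)
      \sum_r [exists p, good d r p])%N%:R =
      \sum_(d : {poly_(N - M).+1 F} | d != 0%R)
         2 * (\sum_r [exists p, good d r p])%N%:R :> R.
    by rewrite natr_sum mulr_sumr.
  apply: le_trans (ler_sum _ (fun d _ => goodr d)).
  (* There are [q^(N-M+1) - 1] nonzero differences, which is at least [q^(N-M)]. *)
  rewrite sumr_const -[leRHS]mulr_natl ler_wpM2r // -natrX ler_nat.
  have := cardC1 (0 : {poly_(N - M).+1 F}); rewrite card_npoly => ->.
  rewrite -/q expnS; have : (0 < q ^ (N - M))%N by rewrite expn_gt0 ltnW.
  move: (q ^ (N - M))%N => k; nia.
suff : (#|W| <= #|solutions3 a b c A| * q ^ (2 * M))%N.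
  rewrite -(ler_nat R) natrM natrX => leW; apply: (le_trans cardW).
  by rewrite -mulrA ler_pM2l ?ltr0n.
pose sel u := odflt (0, 0, 0) [pick p | good u.1 u.2 p].
have selP u : u \in W -> good u.1 u.2 (sel u).
  rewrite inE => /andP [_ /existsP [p pP]]; rewrite /sel.
  by case: pickP => [//|/(_ p)]; rewrite pP.
pose pt u y : {poly_N F} := u.2 + t u.1 y.
(* A solution arises from at most [q^(2M)] pairs [(d, r)]: once the parameters [y1 != y2] are known,
   the difference of the first two entries, [d (y1 - y2)], gives [d], and then [r] follows. *)
pose g u := ((pt u (sel u).1.1, pt u (sel u).1.2, pt u (sel u).2),
  ((sel u).1.1, (sel u).1.2)).
have g_inj : {in W &, injective g}.
  move=> [d r] [d' r'] /selP; rewrite /good /= => /and5P [_ _ _ y_neq _] _.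
  rewrite /g /pt /=; move: y_neq; move: (sel (d, r)) (sel (d', r')).
  move=> [[y1 y2] y3] [[z1 z2] z3] /= y_neq [e1 e2 _ ez1 ez2].
  rewrite -{}ez1 in e1; rewrite -{}ez2 in e2.
  have dd' : d = d'.
    apply/val_inj/eqP; rewrite -subr_eq0 /=.
    have y12 : (y1 : {poly F}) - (y2 : {poly F}) != 0 by rewrite subr_eq0.
    rewrite -(inj_eq (mulIf y12)) mul0r.
    rewrite !tE in e1 e2.
    have elim_r (P P' D D' Y1 Y2 : {poly F}) : P + D * Y1 = P' + D' * Y1 ->
        P + D * Y2 = P' + D' * Y2 -> (D - D') * (Y1 - Y2) = 0.
      move=> E1 E2; transitivity ((P + D * Y1 - (P + D * Y2)) -
        (P' + D' * Y1 - (P' + D' * Y2))); first by ring.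
      by rewrite E1 E2 subrr.
    by apply/eqP; exact: elim_r e1 e2.
  by congr (_, _) => //; apply: val_inj; move: e1; rewrite dd' => /addIr.
rewrite -(card_in_imset g_inj).
have <- : #|finset.setX (solutions3 a b c A) [set: {poly_M F} * {poly_M F}]%SET|
    = (#|solutions3 a b c A| * q ^ (2 * M))%N.
  by rewrite cardsX cardsT card_prod card_npoly mul2n -addnn expnD.
apply/subset_leq_card/fintype.subsetP => _ /imsetP [u uW ->]; rewrite !inE andbT /=.
have /and5P [] := selP _ uW; rewrite !inE /pt => -> -> -> _ /eqP /= eq0 /=.
rewrite !tE; apply/eqP; set y1 := (sel u).1.1 in eq0 *; set y2 := (sel u).1.2 in eq0 *.
set y3 := (sel u).2 in eq0 *.
transitivity ((a + b + c) * (u.2 : {poly F}) + (u.1 : {poly F}) *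
  (a * (y1 : {poly F}) + b * (y2 : {poly F}) + c * (y3 : {poly F}))); first by ring.
by rewrite abc0 eq0 mul0r mulr0 addr0.
Qed.

Lemma exists_expr_lt (R : realType) (rho eps : R) : 0 < rho -> rho < 1 ->
  0 < eps -> exists n : nat, rho ^+ n < eps.
Proof.
move=> rho_gt0 rho_lt1 eps_gt0.
have rho_norm : `|rho| < 1 by rewrite ger0_norm // ltW.
have /cvgrPdist_lt /(_ eps eps_gt0) [n _ /(_ n (leqnn n))] := cvg_expr rho_norm.
by rewrite /= sub0r normrN ger0_norm ?exprn_ge0 ?ltW // => ?; exists n.
Qed.

Lemma card_solutions3_ge (F : finFieldType) (N : nat) (a b c : {poly F})
    (A : {set {poly_N F}}) : a + b + c = 0 -> (#|A| <= #|solutions3 a b c A|)%N.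
Proof.
move=> abc0; pose diag (x : {poly_N F}) := (x, x, x).
have diag_inj : injective diag by move=> x y [].
rewrite -(card_imset _ diag_inj); apply/subset_leq_card/fintype.subsetP => _ /imsetP [x xA ->].
by rewrite inE /= xA -!mulrDl abc0 mul0r eqxx.
Qed.

Lemma density_ge0 (R : realType) (F : finFieldType) (N : nat)
    (A : {set {poly_N F}}) : 0 <= density R A.
Proof. by rewrite divr_ge0. Qed.

Lemma density_le1 (R : realType) (F : finFieldType) (N : nat)
    (A : {set {poly_N F}}) : density R A <= 1.
Proof.
have pos : (0 < #|[set: {poly_N F}]|)%N by apply/card_gt0P; exists 0; rewrite inE.
by rewrite /density ler_pdivrMr ?ltr0n // mul1r ler_nat subset_leq_card // finset.subsetT.
Qed.

Lemma density_card (R : realType) (F : finFieldType) (N : nat)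
    (A : {set {poly_N F}}) : #|A|%:R = density R A * #|F|%:R ^+ N.
Proof.
have q_gt0 : (0 < #|F|)%N by apply/card_gt0P; exists 0.
rewrite /density cardsT card_npoly natrX divfK //.
by rewrite expf_neq0 // pnatr_eq0 -lt0n.
Qed.

(** Averaging loses a factor [q^(3M)]. For the least [M] with [2 C rho^M <= alpha] this loss is
    polynomial in [1 / alpha]. *)
Lemma solutions3_lower_bound (R : realType) (q l : nat) : (1 < q)%N ->
  exists (kappa : R) (K : nat), 0 < kappa /\
    forall (F : finFieldType) (N : nat) (a b c : {poly F}) (A : {set {poly_N F}}),
      #|F| = q ->
      (size a <= l.+1)%N -> (size b <= l.+1)%N -> (size c <= l.+1)%N ->
      c != 0 -> a + b + c = 0 ->
      kappa * density R A ^+ K.+1 * q%:R ^+ (2 * N) <= #|solutions3 a b c A|%:R.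
Proof.
move=> q_gt1; have [C [rho [C_ge1 rho_gt0 rho_lt1 bound]]] := solution_free_density R l q_gt1.
have q_gt0 : 0 < q%:R :> R by rewrite ltr0n ltnW.
have qV_gt0 : 0 < q%:R^-1 :> R by rewrite invr_gt0.
(* [k] converts powers of [rho] into powers of [1 / q], which makes the final exponent [3 k + 1]. *)
have [k rhok] := exists_expr_lt rho_gt0 rho_lt1 qV_gt0.
have C2_gt0 : 0 < 2 * C by lra.
exists ((rho / (2 * C)) ^+ (k * 3) / 2), (k * 3)%N; split.
  by rewrite divr_gt0 // exprn_gt0 // divr_gt0.
move=> F N a b c A Fq sa sb sc c_neq0 abc0; set al := density R A.
have al_le1 : al <= 1 by exact: density_le1.
have [al0|al_neq0] := eqVneq al 0; first by rewrite al0 expr0n mulr0 mul0r.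
have al_gt0 : 0 < al by rewrite lt_def al_neq0 density_ge0.
have exM : exists M, 2 * C * rho ^+ M <= al.
  have [M hM] := exists_expr_lt rho_gt0 rho_lt1 (divr_gt0 al_gt0 C2_gt0).
  by exists M; rewrite mulrC -ler_pdivlMr // ltW.
(* [M = 0] is excluded because [2 C >= 2 > alpha]. *)
case: (ex_minnP exM) => -[|M] hM minM; first by move: hM; rewrite expr0; lra.
have al_lt : al < 2 * C * rho ^+ M.
  by rewrite ltNge; apply/negP => /minM; rewrite ltnn.
set S : R := #|solutions3 a b c A|%:R.
have key : al * q%:R ^+ (2 * N) <= 2 * S * q%:R ^+ (3 * M.+1).
  have [MN|NM] := leqP M.+1 N.
    have h : q%:R ^+ (N - M.+1) * (al * q%:R ^+ N) <= 2 * S * q%:R ^+ (2 * M.+1).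
      have := @varnavides R F N M.+1 a b c A (C * rho ^+ M.+1) MN c_neq0 abc0.
      rewrite density_card -/al -/S Fq; apply.
        by move=> B; exact: bound.
      by rewrite mulrA ler_pM2r // exprn_gt0.
    have -> : (2 * N = (N - M.+1) + M.+1 + N)%N by rewrite subnK // addnn mul2n.
    have -> : (3 * M.+1 = 2 * M.+1 + M.+1)%N by rewrite (mulnDl 2 1) mul1n.
    rewrite !exprD; have := ler_wpM2r (exprn_ge0 M.+1 (ltW q_gt0)) h.
    move: (q%:R ^+ (N - M.+1)) (q%:R ^+ M.+1) (q%:R ^+ (2 * M.+1)) (q%:R ^+ N) => u1 u2 u3 u4.
    by lra.
  (* Here the progressions do not fit in [G_N], but [N] is so small that the diagonal solutions are
     enough. *)
  have AS : al * q%:R ^+ N <= S by rewrite -Fq -density_card ler_nat card_solutions3_ge.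
  rewrite mul2n -addnn exprD mulrA.
  have qN : q%:R ^+ N <= q%:R ^+ (3 * M.+1) :> R.
    by rewrite ler_eXn2l ?ltr1n // (leq_trans (ltnW NM)) // leq_pmull.
  have qN_ge0 : 0 <= q%:R ^+ N :> R by rewrite exprn_ge0 // ltW.
  have S_ge0 : 0 <= S by exact: ler0n.
  apply: le_trans (_ : S * q%:R ^+ (3 * M.+1) <= _).
    by apply: ler_pM => //; rewrite mulr_ge0 // ltW.
  by rewrite ler_wpM2r ?(exprn_ge0 _ (ltW q_gt0)) //; lra.
(* By minimality [rho alpha / (2 C)] is at most [rho^(M+1)]; now raise to the power [3 k] and use
   [rho^k < 1 / q]. *)
have qV : (rho / (2 * C) * al) ^+ (k * 3) <= q%:R ^- (3 * M.+1).
  have base : rho / (2 * C) * al <= rho ^+ M.+1.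
    have := ler_wpM2l (ltW (divr_gt0 rho_gt0 C2_gt0)) (ltW al_lt).
    suff -> : rho / (2 * C) * (2 * C * rho ^+ M) = rho ^+ M.+1 by [].
    by rewrite mulrA divfK ?gt_eqF // exprS.
  have base_ge0 : 0 <= rho / (2 * C) * al by rewrite mulr_ge0 ?ltW // divr_gt0.
  apply: (@le_trans _ _ ((rho ^+ M.+1) ^+ (k * 3))).
    by apply: lerXn2r; rewrite ?nnegrE // exprn_ge0 // ltW.
  have -> : rho ^+ M.+1 ^+ (k * 3) = (rho ^+ k) ^+ (3 * M.+1).
    by rewrite -!exprM; congr (_ ^+ _); rewrite mulnCA (mulnC M.+1).
  by rewrite -exprVn; apply: lerXn2r; rewrite ?nnegrE ?(exprn_ge0 _ (ltW rho_gt0)) ?ltW.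
have q3_gt0 : 0 < q%:R ^+ (3 * M.+1) :> R by rewrite exprn_gt0.
rewrite exprMn -(ler_pM2r q3_gt0) mulVf ?gt_eqF // in qV.
rewrite -(ler_pM2r q3_gt0) exprS -(@ler_pM2l _ 2) //.
apply: le_trans (_ : al * q%:R ^+ (2 * N) <= _); last by rewrite mulrA.
have := ler_wpM2l (mulr_ge0 (ltW al_gt0) (exprn_ge0 (2 * N) (ltW q_gt0))) qV.
rewrite mulr1; set X := _ / _.
by move: (X ^+ _) (al ^+ _) (q%:R ^+ (2 * N)) (q%:R ^+ (3 * _)) => u1 u2 u3 u4; lra.
Qed.

(** * Counting solutions along a list of coefficients *)

(** Lists make it easy to permute, merge and drop coefficients; [e] is what the remaining terms must
    sum to. *)
Fixpoint count_solutions (F : finFieldType) (N : nat) (A : {set {poly_N F}})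
    (cs : seq {poly F}) (e : {poly F}) : nat :=
  if cs is c :: cs' then
    (\sum_(x in A) count_solutions A cs' (e - c * (x : {poly F})))%N
  else (e == 0).

Lemma leq_sum_inj (T T' : finType) (Y : {set T}) (Z : {set T'}) (phi : T -> T')
    (f : T' -> nat) :
  {in Y &, injective phi} -> (forall y, y \in Y -> phi y \in Z) ->
  (\sum_(y in Y) f (phi y) <= \sum_(z in Z) f z)%N.
Proof.
move=> phi_inj phiZ; rewrite -(big_imset f phi_inj) /=.
rewrite [leqRHS](bigID (mem (phi @: Y)%SET)) /=.
apply: leq_trans (leq_addr _ _); rewrite leq_eqVlt; apply/orP; left; apply/eqP.
apply: eq_bigl => z; rewrite andb_idl // => /imsetP [y yY ->]; exact: phiZ.
Qed.

Lemma count_solutions_front (F : finFieldType) (N : nat) (A : {set {poly_N F}})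
    (c : {poly F}) (s1 s2 : seq {poly F}) (e : {poly F}) :
  count_solutions A (s1 ++ c :: s2) e = count_solutions A (c :: s1 ++ s2) e.
Proof.
elim: s1 e => [//|c' s1 IHs] e /=; under eq_bigr => x _ do rewrite IHs /=.
rewrite exchange_big; apply: eq_bigr => x _; apply: eq_bigr => y _.
by rewrite -!addrA [- _ - _]addrC.
Qed.

Lemma count_solutions_perm (F : finFieldType) (N : nat) (A : {set {poly_N F}})
    (cs cs' : seq {poly F}) (e : {poly F}) :
  perm_eq cs cs' -> count_solutions A cs e = count_solutions A cs' e.
Proof.
elim: cs cs' e => [|c cs IHcs] cs' e.
  by rewrite perm_sym => /perm_nilP ->.
move=> ecs; have c_in : c \in cs' by rewrite -(perm_mem ecs) mem_head.
move: ecs; case/splitPr: c_in => s1 s2; rewrite perm_sym -[c :: s2]cat1s perm_catCA /= perm_cons perm_sym => ecs.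
by rewrite count_solutions_front /=; apply: eq_bigr => x _; apply: IHcs.
Qed.

Lemma count_solutions_sub (F : finFieldType) (N : nat) (A B : {set {poly_N F}})
    (cs : seq {poly F}) (e : {poly F}) :
  A \subset B -> (count_solutions A cs e <= count_solutions B cs e)%N.
Proof.
move=> AB; elim: cs e => [//|c cs IHcs] e /=.
apply: (@leq_trans (\sum_(x in A) count_solutions B cs (e - c * (x : {poly F}))%R)%N).
  by apply: leq_sum => x _; exact: IHcs.
by apply: (@leq_sum_inj _ _ A B id) => // y; exact: (fintype.subsetP AB).
Qed.

(** Serves to bring two coefficients with nonzero sum to the front. *)
Lemma not_pairwise_perm (T : eqType) (r : rel T) (s : seq T) :
  ~~ pairwise r s -> exists x y s', perm_eq s (x :: y :: s') /\ ~~ r x y.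
Proof.
elim: s => [//|c s IHs]; rewrite pairwise_cons negb_and.
case/orP => [/allPn [y ys nr]|/IHs [x [y [s' [ps nr]]]]].
  by exists c, y, (rem y s); split; rewrite ?perm_cons ?perm_to_rem.
exists x, y, (c :: s'); split=> //; apply: (@perm_trans _ [:: c, x, y & s']).
  by rewrite perm_cons.
by rewrite -[_ :: _]/([:: c] ++ [:: x; y] ++ s') perm_catCA.
Qed.

(** * Substitutions that reduce the number of variables *)

(** Besides the two translates, [z] itself stays in [A], so that the remaining variables, restricted
    to the same set, are still in [A]. *)
Definition pair_shift (F : finFieldType) (N : nat) (A : {set {poly_N F}})
    (p : {poly_N F} * {poly_N F}) : {set {poly_N F}} :=
  [set z in A | (z + p.1 \in A) && (z + p.2 \in A)].

Definition pair_kernel (F : finFieldType) (N : nat) (c1 c2 : {poly F}) :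
    {set {poly_N F} * {poly_N F}} :=
  [set p : {poly_N F} * {poly_N F} | c1 * (p.1 : {poly F}) + c2 * (p.2 : {poly F}) == 0].

(** For [(u, v)] in the kernel, [x1 = z + u] and [x2 = z + v] give [c1 x1 + c2 x2 = (c1 + c2) z]. As
    [c1 + c2 != 0] this determines [z], hence also [u] and [v], so no solution is counted twice. *)
Lemma count_solutions_merge (F : finFieldType) (N : nat) (A : {set {poly_N F}})
    (c1 c2 : {poly F}) (cs : seq {poly F}) : c1 + c2 != 0 ->
  (\sum_(p in pair_kernel N c1 c2) count_solutions (pair_shift A p) ((c1 + c2)%R :: cs) 0
     <= count_solutions A [:: c1, c2 & cs] 0)%N.
Proof.
move=> c12_neq0; set H := pair_kernel N c1 c2.
pose f (p : {poly_N F} * {poly_N F}) :=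
  count_solutions A cs (0 - c1 * (p.1 : {poly F}) - c2 * (p.2 : {poly F})).
pose Y := [set u : ({poly_N F} * {poly_N F}) * {poly_N F} |
  (u.1 \in H) && (u.2 \in pair_shift A u.1)].
pose phi (u : ({poly_N F} * {poly_N F}) * {poly_N F}) := (u.2 + u.1.1, u.2 + u.1.2).
apply: (@leq_trans (\sum_(u in Y) f (phi u))).
  rewrite (eq_bigl (fun u : ({poly_N F} * {poly_N F}) * {poly_N F} =>
    (u.1 \in H) && (u.2 \in pair_shift A u.1))) => [|u]; last by rewrite inE.
  rewrite -(pair_big_dep (mem H) (fun p z => z \in pair_shift A p)
    (fun p z => f (phi (p, z)))) /=.
  apply: leq_sum => p; rewrite inE => /eqP p0; apply: leq_sum => z _.
  apply: leq_trans (count_solutions_sub _ _ (_ : pair_shift A p \subset A)) _.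
    by apply/fintype.subsetP => x; rewrite inE => /andP [].
  rewrite leq_eqVlt; apply/orP; left; apply/eqP; congr (count_solutions _ _ _).
  rewrite /phi /=; transitivity (0 - (c1 + c2) * (z : {poly F}) -
    (c1 * (p.1 : {poly F}) + c2 * (p.2 : {poly F}))); last by ring.
  by rewrite p0 subr0.
apply: leq_trans (_ : \sum_(p in finset.setX A A) f p <= _)%N; last first.
  rewrite (eq_bigl (fun p : {poly_N F} * {poly_N F} => (p.1 \in A) && (p.2 \in A))) => [|p].
    by rewrite -(pair_big (mem A) (mem A) (fun x y => f (x, y))).
  by rewrite inE.
apply: leq_sum_inj => [|[p z]]; last by rewrite !inE /= => /and4P [_ _ -> ->].
move=> [[u v] z] [[u' v'] z']; rewrite !inE /= => /andP [/eqP k0 _] /andP [/eqP k0' _] [e1 e2].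
have zz' : z = z'.
  apply/val_inj/eqP; rewrite -subr_eq0 -(inj_eq (mulfI c12_neq0)) mulr0 /=.
  have -> : (c1 + c2) * ((z : {poly F}) - (z' : {poly F})) =
    c1 * ((z : {poly F}) + (u : {poly F})) + c2 * ((z : {poly F}) + (v : {poly F}))
    - (c1 * ((z' : {poly F}) + (u' : {poly F})) + c2 * ((z' : {poly F}) + (v' : {poly F})))
    - ((c1 * (u : {poly F}) + c2 * (v : {poly F}))
       - (c1 * (u' : {poly F}) + c2 * (v' : {poly F}))) by ring.
  by rewrite k0 k0' e1 e2 !subrr.
by move: e1 e2; rewrite zz' => /addrI /val_inj -> /addrI /val_inj ->.
Qed.

Lemma card_pair_kernel (F : finFieldType) (N : nat) (c1 c2 : {poly F}) :
  c2 != 0 -> (#|pair_kernel N c1 c2| <= #|F| ^ N)%N.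
Proof.
move=> c2_neq0; rewrite -card_npoly.
have fst_inj : {in pair_kernel N c1 c2 &, injective (@fst {poly_N F} {poly_N F})}.
  move=> [u v] [u' v']; rewrite !inE /= => /eqP k0 /eqP k0' uu'; rewrite uu'.
  congr (_, _); apply/val_inj/(mulfI c2_neq0)/(addrI (c1 * (u' : {poly F}))).
  by rewrite k0' -k0 uu'.
by rewrite -(card_in_imset fst_inj) max_card.
Qed.

(** A solution [(x, y, z)] gives the kernel pair [(x - z, y - z)] and the point [z] of the
    corresponding intersection. The three-variable bound thus controls the average intersection. *)
Lemma sum_card_pair_shift (F : finFieldType) (N : nat) (A : {set {poly_N F}})
    (c1 c2 : {poly F}) :
  (#|solutions3 c1 c2 (- (c1 + c2)) A|
     <= \sum_(p in pair_kernel N c1 c2) #|pair_shift A p|)%N.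
Proof.
pose Y := [set u : ({poly_N F} * {poly_N F}) * {poly_N F} |
  (u.1 \in pair_kernel N c1 c2) && (u.2 \in pair_shift A u.1)].
have -> : (\sum_(p in pair_kernel N c1 c2) #|pair_shift A p| = \sum_(u in Y) 1)%N.
  rewrite (eq_bigl (fun u : ({poly_N F} * {poly_N F}) * {poly_N F} =>
    (u.1 \in pair_kernel N c1 c2) && (u.2 \in pair_shift A u.1))) => [|u]; last by rewrite inE.
  rewrite -(pair_big_dep (mem (pair_kernel N c1 c2)) (fun p z => z \in pair_shift A p)
    (fun p z => 1%N)) /=.
  by apply: eq_bigr => p _; rewrite sum1_card.
pose phi (p : {poly_N F} * {poly_N F} * {poly_N F}) :=
  ((p.1.1 - p.2, p.1.2 - p.2), p.2).
rewrite -sum1_card; apply: (@leq_sum_inj _ _ _ Y phi (fun=> 1%N)).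
  by move=> [[x y] z] [[x' y'] z'] _ _ [] /= + + zz'; rewrite zz' => /addIr /val_inj -> /addIr /val_inj ->.
move=> [[x y] z]; rewrite !inE /= => /and4P [xA yA zA /eqP e0].
rewrite zA !(addrC z) !subrK xA yA !andbT; apply/eqP; rewrite -[RHS]e0; ring.
Qed.

(** With equal shifts the set is [A] intersected with [A - u], and each ordered pair of points of
    [A] has exactly one difference [u]. *)
Lemma sum_card_shift (F : finFieldType) (N : nat) (A : {set {poly_N F}}) :
  (\sum_(u : {poly_N F}) #|pair_shift A (u, u)| = #|A| * #|A|)%N.
Proof.
transitivity (\sum_(u : {poly_N F}) \sum_(z in A | (z + u)%R \in A) 1)%N.
  by apply: eq_bigr => u _; rewrite -sum1_card; apply: eq_bigl => z; rewrite inE /= andbb.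
rewrite (exchange_big_dep (mem A)) => [/=|u z _ /andP []//].
rewrite -sum_nat_const; apply: eq_bigr => z zA.
rewrite -[RHS]sum1_card [RHS](reindex_inj (addrI z)).
by apply: eq_bigl => u; rewrite zA.
Qed.

(* Substitute [x1 = z1 + u], [x2 = z1], [x3 = z3 + u]. *)
Lemma count_solutions_opposite (F : finFieldType) (N : nat) (A : {set {poly_N F}})
    (c1 c2 c3 : {poly F}) (cs : seq {poly F}) : c1 + c2 = 0 -> c1 + c3 = 0 ->
  (\sum_(u : {poly_N F}) #|pair_shift A (u, u)| *
       count_solutions (pair_shift A (u, u)) (c3 :: cs) 0
     <= count_solutions A [:: c1, c2, c3 & cs] 0)%N.
Proof.
move=> c12 c13.
pose h (x1 x2 : {poly_N F}) := (\sum_(x3 in A) count_solutions A cs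
  (0 - c1 * (x1 : {poly F}) - c2 * (x2 : {poly F}) - c3 * (x3 : {poly F}))%R)%N.
apply: (@leq_trans (\sum_(u : {poly_N F}) \sum_(z in pair_shift A (u, u)) h (z + u)%R z)).
  apply: leq_sum => u _; rewrite -sum_nat_const; apply: leq_sum => z _ /=.
  apply: (@leq_trans (\sum_(z3 in pair_shift A (u, u)) count_solutions A cs
    (0 - c1 * ((z + u)%R : {poly F}) - c2 * (z : {poly F})
       - c3 * ((z3 + u)%R : {poly F}))%R)); last first.
    apply: (@leq_sum_inj _ _ _ _ (fun z3 => z3 + u) (fun x3 => count_solutions A cs
      (0 - c1 * ((z + u)%R : {poly F}) - c2 * (z : {poly F}) - c3 * (x3 : {poly F})))).
      by move=> x y _ _ /addIr.
    by move=> y; rewrite inE => /and3P [].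
  apply: leq_sum => z3 _; apply: leq_trans (count_solutions_sub _ _ (_ : _ \subset A)) _.
    by apply/fintype.subsetP => x; rewrite inE => /andP [].
  rewrite leq_eqVlt; apply/orP; left; apply/eqP; congr (count_solutions _ _ _).
  rewrite /=; transitivity (0 - c3 * (z3 : {poly F}) - (c1 + c2) * (z : {poly F})
    - (c1 + c3) * (u : {poly F})); last by ring.
  by rewrite c12 c13 !mul0r !subr0.
rewrite -[count_solutions _ _ _]/(\sum_(x1 in A) \sum_(x2 in A) h x1 x2)%N.
rewrite [leqRHS]exchange_big /= leq_eqVlt; apply/orP; left; apply/eqP.
transitivity (\sum_(u : {poly_N F}) \sum_(z in A | (z + u)%R \in A) h (z + u)%R z)%N.
  by apply: eq_bigr => u _; apply: eq_bigl => z; rewrite inE /= andbb.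
rewrite (exchange_big_dep (mem A)) => [/=|u z _ /andP []//].
apply: eq_bigr => z zA; rewrite [RHS](reindex_inj (addrI z)).
by apply: eq_bigl => u; rewrite zA.
Qed.

(** * Supersaturation by induction on the number of variables *)

(** Pointwise, [(beta / 2)^K (w - beta / 2) <= w^K]: the left side is nonpositive below [beta / 2],
    and above it the second factor is at most 1. Summing loses at most half of [beta Q]. *)
Lemma power_mean_lower_bound (R : realFieldType) (T : finType) (P : pred T)
    (w : T -> R) (beta Q : R) (K : nat) :
  (forall p, 0 <= w p <= 1) -> 0 <= beta -> #|P|%:R <= Q ->
  beta * Q <= \sum_(p | P p) w p ->
  (beta / 2) ^+ K.+1 * Q <= \sum_(p | P p) w p ^+ K.
Proof.
move=> w01 beta_ge0 cardQ sumw; have b2_ge0 : 0 <= beta / 2 by rewrite divr_ge0.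
have b2K : 0 <= (beta / 2) ^+ K by rewrite exprn_ge0.
have pointwise p : (beta / 2) ^+ K * (w p - beta / 2) <= w p ^+ K.
  have /andP [w_ge0 w_le1] := w01 p.
  have [le_bw|lt_wb] := leP (beta / 2) (w p); last first.
    by apply: le_trans (exprn_ge0 K w_ge0); rewrite mulr_ge0_le0 // subr_le0 ltW.
  apply: (@le_trans _ _ ((beta / 2) ^+ K)); first by rewrite ler_piMr //; lra.
  by apply: lerXn2r.
apply: le_trans (ler_sum _ (fun p _ => pointwise p)).
rewrite -mulr_sumr sumrB sumr_const -[_ *+ #|_|]mulr_natr exprSr -mulrA.
apply: ler_wpM2l => //; have := ler_wpM2l b2_ge0 cardQ; lra.
Qed.

(** The expected count is [q^((n-1)N)]; the factor [q^N] on the right avoids the subtraction. The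
    constants are uniform in the field of order [q], in [N], [A] and the coefficients. *)
Definition supersaturated (R : realType) (q l n : nat) : Prop :=
  exists (kappa : R) (K : nat), 0 < kappa /\
    forall (F : finFieldType) (N : nat) (A : {set {poly_N F}}) (cs : seq {poly F}),
      #|F| = q -> size cs = n ->
      all (fun c : {poly F} => (c != 0) && (size c <= l.+1)%N) cs ->
      \sum_(c <- cs) c = 0 ->
      kappa * density R A ^+ K.+1 * q%:R ^+ (n * N)
        <= (count_solutions A cs 0)%:R * q%:R ^+ N.

(** The intersections have average density at least [k3 alpha^(K3+1)], and the power mean carries
    this through the exponent of the shorter equation. The merged coefficient keeps the size bound,
    so the same constants apply to every intersection. *)
Lemma supersaturated_merge (R : realType) (q l n : nat) : (1 < q)%N ->
  supersaturated R q l n.+1 ->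
  exists (kappa : R) (K : nat), 0 < kappa /\
    forall (F : finFieldType) (N : nat) (A : {set {poly_N F}}) (c1 c2 : {poly F})
      (cs : seq {poly F}),
      #|F| = q -> size cs = n -> c1 + c2 != 0 ->
      all (fun c : {poly F} => (c != 0) && (size c <= l.+1)%N) [:: c1, c2 & cs] ->
      \sum_(c <- [:: c1, c2 & cs]) c = 0 ->
      kappa * density R A ^+ K.+1 * q%:R ^+ (n.+2 * N)
        <= (count_solutions A [:: c1, c2 & cs] 0)%:R * q%:R ^+ N.
Proof.
move=> q_gt1 [k1 [K1 [k1_gt0 bound1]]].
have [k3 [K3 [k3_gt0 bound3]]] := solutions3_lower_bound R l q_gt1.
have q_gt0 : 0 < q%:R :> R by rewrite ltr0n ltnW.
exists (k1 * (k3 / 2) ^+ K1.+2), (K1.+1 + K3 * K1.+2)%N; split.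
  by rewrite mulr_gt0 // exprn_gt0 // divr_gt0.
move=> F N A c1 c2 cs Fq scs c12 /= /and3P [/andP [c1_neq0 sc1] /andP [c2_neq0 sc2] allcs].
rewrite !big_cons addrA => sum0; set al := density R A.
have al_ge0 : 0 <= al by exact: density_ge0.
rewrite (_ : (K1.+1 + K3 * K1.+2).+1 = K3.+1 * K1.+2)%N; last by rewrite mulSn.
have sc12 : (size (c1 + c2)%R <= l.+1)%N.
  by rewrite (leq_trans (size_polyD _ _)) // geq_max sc1 sc2.
pose w p := density R (pair_shift A p).
pose beta := k3 * al ^+ K3.+1.
have beta_ge0 : 0 <= beta by rewrite mulr_ge0 ?exprn_ge0 // ltW.
have qN_gt0 : 0 < q%:R ^+ N :> R by rewrite exprn_gt0.
have mean : (beta / 2) ^+ K1.+2 * q%:R ^+ N <=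
    \sum_(p in pair_kernel N c1 c2) w p ^+ K1.+1.
  apply: power_mean_lower_bound => //.
  - by move=> p; rewrite density_ge0 density_le1.
  - by rewrite -natrX ler_nat -Fq card_pair_kernel.
  rewrite -(ler_pM2r qN_gt0) -mulrA -exprD addnn -mul2n mulr_suml.
  apply: le_trans (bound3 F N c1 c2 (- (c1 + c2)) A Fq sc1 sc2 _ _ _) _.
  - by rewrite size_polyN.
  - by rewrite oppr_eq0.
  - by rewrite subrr.
  rewrite (eq_bigr (fun p => #|pair_shift A p|%:R)) => [|p _]; last first.
    by rewrite density_card Fq.
  by rewrite -natr_sum ler_nat sum_card_pair_shift.
apply: (@le_trans _ _ (\sum_(p in pair_kernel N c1 c2)
    (k1 * w p ^+ K1.+1 * q%:R ^+ (n.+1 * N)))).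
  rewrite -mulr_suml -mulr_sumr [(n.+2 * N)%N]mulSn exprD.
  have qn_gt0 : 0 < q%:R ^+ (n.+1 * N) :> R by rewrite exprn_gt0.
  have betaE : (k3 / 2) ^+ K1.+2 * al ^+ (K3.+1 * K1.+2) = (beta / 2) ^+ K1.+2.
    by rewrite exprM -exprMn mulrAC.
  rewrite -[k1 * _ * al ^+ _]mulrA betaE [leLHS]mulrA ler_pM2r //.
  by rewrite -[k1 * _ * q%:R ^+ N]mulrA ler_pM2l.
apply: (@le_trans _ _ (\sum_(p in pair_kernel N c1 c2)
    (count_solutions (pair_shift A p) ((c1 + c2) :: cs) 0)%:R * q%:R ^+ N)).
  apply: ler_sum => p _; apply: bound1 => //=.
  - by rewrite scs.
  - by rewrite c12 sc12 allcs.
  by rewrite big_cons.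
rewrite -mulr_suml ler_pM2r // -natr_sum ler_nat.
exact: count_solutions_merge.
Qed.

(** The first two coefficients cancel, so [c3 :: cs] still sums to zero. The average density of the
    intersections is [alpha^2], and the free variable [z1] contributes one more factor of that
    density, hence the power [K1.+2]. *)
Lemma supersaturated_opposite (R : realType) (q l n : nat) : (1 < q)%N ->
  supersaturated R q l n.+1 ->
  exists (kappa : R) (K : nat), 0 < kappa /\
    forall (F : finFieldType) (N : nat) (A : {set {poly_N F}}) (c1 c2 c3 : {poly F})
      (cs : seq {poly F}),
      #|F| = q -> size cs = n -> c1 + c2 = 0 -> c1 + c3 = 0 ->
      all (fun c : {poly F} => (c != 0) && (size c <= l.+1)%N) [:: c1, c2, c3 & cs] ->
      \sum_(c <- [:: c1, c2, c3 & cs]) c = 0 ->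
      kappa * density R A ^+ K.+1 * q%:R ^+ (n.+3 * N)
        <= (count_solutions A [:: c1, c2, c3 & cs] 0)%:R * q%:R ^+ N.
Proof.
move=> q_gt1 [k1 [K1 [k1_gt0 bound1]]].
have q_gt0 : 0 < q%:R :> R by rewrite ltr0n ltnW.
exists (k1 * (1 / 2) ^+ K1.+3), (K1.+2 + K1.+3)%N; split.
  by rewrite mulr_gt0 // exprn_gt0 // divr_gt0.
move=> F N A c1 c2 c3 cs Fq scs c12 c13 /= /and3P [_ _ allcs].
rewrite !big_cons addrA c12 add0r => sum0; set al := density R A.
have al_ge0 : 0 <= al by exact: density_ge0.
rewrite (_ : (K1.+2 + K1.+3).+1 = 2 * K1.+3)%N; last by rewrite mul2n -addnn.
pose w (u : {poly_N F}) := density R (pair_shift A (u, u)).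
have qN_gt0 : 0 < q%:R ^+ N :> R by rewrite exprn_gt0.
have mean : (al ^+ 2 / 2) ^+ K1.+3 * q%:R ^+ N <=
    \sum_(u : {poly_N F}) w u ^+ K1.+2.
  apply: power_mean_lower_bound => //.
  - by move=> p; rewrite density_ge0 density_le1.
  - by rewrite exprn_ge0.
  - by rewrite card_npoly Fq natrX.
  rewrite -(ler_pM2r qN_gt0) mulr_suml.
  rewrite (eq_bigr (fun u => #|pair_shift A (u, u)|%:R)) => [|u _]; last first.
    by rewrite density_card Fq.
  rewrite -natr_sum sum_card_shift natrM density_card -/al Fq.
  by move: (q%:R ^+ N) => Q; lra.
apply: (@le_trans _ _ (\sum_(u : {poly_N F})
    (k1 * w u ^+ K1.+2 * q%:R ^+ (n.+2 * N)))).
  rewrite -mulr_suml -mulr_sumr [(n.+3 * N)%N]mulSn exprD.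
  have qn_gt0 : 0 < q%:R ^+ (n.+2 * N) :> R by rewrite exprn_gt0.
  have alE : (1 / 2) ^+ K1.+3 * al ^+ (2 * K1.+3) = (al ^+ 2 / 2) ^+ K1.+3.
    by rewrite exprM -exprMn mul1r mulrC.
  rewrite -[k1 * _ * al ^+ _]mulrA alE [leLHS]mulrA ler_pM2r //.
  by rewrite -[k1 * _ * q%:R ^+ N]mulrA ler_pM2l.
apply: (@le_trans _ _ (\sum_(u : {poly_N F})
    (#|pair_shift A (u, u)| *
     count_solutions (pair_shift A (u, u)) (c3 :: cs) 0)%N%:R * q%:R ^+ N)).
  apply: ler_sum => u _; rewrite natrM density_card -/(w u) Fq.
  have w_ge0 : 0 <= w u * q%:R ^+ N by rewrite mulr_ge0 ?density_ge0 // ltW.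
  have := bound1 F N (pair_shift A (u, u)) (c3 :: cs) Fq (congr1 S scs) allcs.
  rewrite big_cons => /(_ sum0).
  move/(ler_wpM2l w_ge0); rewrite -/(w u) -[(n.+2 * N)%N]/(N + n.+1 * N)%N exprD [w u ^+ K1.+2]exprS.
  move: (q%:R ^+ N) (q%:R ^+ (n.+1 * N)) (w u ^+ K1.+1) (count_solutions _ _ _)%:R.
  by move=> u1 u2 u3 u4; lra.
rewrite -mulr_suml ler_pM2r // -natr_sum ler_nat.
exact: count_solutions_opposite.
Qed.

(** The diagonal [x1 = x2] alone supplies [|A|] solutions. *)
Lemma supersaturated_pair (R : realType) (q l : nat) : supersaturated R q l 2.
Proof.
exists 1, 0%N; split=> // F N A [|c1 [|c2 []]] // Fq _ _.
rewrite !big_cons big_nil addr0 => c12; rewrite mul1r expr1 mul2n -addnn exprD mulrA.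
rewrite ler_wpM2r ?exprn_ge0 // -Fq -density_card ler_nat -sum1_card.
apply: leq_sum => x xA; rewrite (bigD1 x) //= sub0r -opprD -mulrDl c12 mul0r oppr0 eqxx.
exact: leq_addr.
Qed.

(** Either two coefficients have nonzero sum and are merged, or all pairwise sums vanish, in
    particular [c1 + c2 = c1 + c3 = 0]. Since [alpha <= 1], the smaller constant with the sum of the
    exponents covers both cases. *)
Lemma supersaturated_step (R : realType) (q l n : nat) : (1 < q)%N ->
  supersaturated R q l n.+1 -> supersaturated R q l n.+2 ->
  supersaturated R q l n.+3.
Proof.
move=> q_gt1 /(supersaturated_opposite q_gt1) [k1 [K1 [k1_gt0 bound1]]].
move=> /(supersaturated_merge q_gt1) [k2 [K2 [k2_gt0 bound2]]].
exists (Num.min k1 k2), (K1 + K2)%N; split; first by rewrite lt_min k1_gt0.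
move=> F N A cs Fq scs allcs sum0; set al := density R A.
have weaken k K : Num.min k1 k2 <= k -> (K <= K1 + K2)%N -> 0 < k ->
    Num.min k1 k2 * al ^+ (K1 + K2).+1 * q%:R ^+ (n.+3 * N)
      <= k * al ^+ K.+1 * q%:R ^+ (n.+3 * N).
  move=> le_k le_K k_gt0; rewrite ler_wpM2r ?exprn_ge0 //.
  have al_ge0 : 0 <= al by exact: density_ge0.
  apply: ler_pM; rewrite ?exprn_ge0 //; first by rewrite le_min !ltW.
  by apply: ler_wiXn2l => //; exact: density_le1.
have [opp|/not_pairwise_perm] := boolP (pairwise (fun c c' : {poly F} => c + c' == 0) cs).
  apply: le_trans (weaken _ _ (_ : _ <= k1) (leq_addr _ _) k1_gt0) _.
    by rewrite ge_min lexx.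
  case: cs scs opp allcs sum0 => [|c1 [|c2 [|c3 cs]]] //= [scs].
  case/andP => /and3P [/eqP c12 /eqP c13 _] _ allcs sum0.
  exact: bound1.
move=> [c1 [c2 [cs' [pcs c12]]]].
apply: le_trans (weaken _ _ (_ : _ <= k2) (leq_addl _ _) k2_gt0) _.
  by rewrite ge_min lexx orbT.
rewrite (count_solutions_perm _ _ pcs); apply: bound2 => //.
- by have := perm_size pcs; rewrite scs => -[].
- by rewrite -(perm_all _ pcs).
by rewrite -(perm_big _ pcs).
Qed.

Lemma supersaturation (R : realType) (q l n : nat) : (1 < q)%N ->
  supersaturated R q l n.+1.
Proof.
(* Two consecutive lengths are carried along because the opposite case descends by two. *)
move=> q_gt1; suff : supersaturated R q l n.+1 /\ supersaturated R q l n.+2 by case.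
elim: n => [|n [IH1 IH2]]; last by split=> //; exact: supersaturated_step.
split; last exact: supersaturated_pair.
(* Length one is vacuous: a single nonzero coefficient does not sum to zero. *)
exists 1, 0%N; split=> // F N A [|c []] //= _ _.
by rewrite big_seq1 => /andP [/andP [/negP c_neq0 _] _] c0; case: c_neq0; rewrite c0.
Qed.

(** * Return to [Lambda] and conclusion *)

Lemma count_solutions_le (F : finFieldType) (N s : nat) (A : {set {poly_N F}})
    (c : 'I_s -> {poly F}) (e : {poly F}) :
  (count_solutions A [seq c i | i <- enum 'I_s] e <=
   #|[set x : {ffun 'I_s -> {poly_N F}} | [forall i, x i \in A] &&
       (\sum_(i < s) c i * (x i : {poly F}) == e)%R]|)%N.
Proof.
elim: s c e => [|s IHs] c e.
  rewrite (size0nil (size_enum_ord 0)) /=; case: eqP => // ->.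
  rewrite lt0n cards_eq0; apply/finset.set0Pn; exists [ffun i => 0]; rewrite inE.
  by rewrite big_ord0 eqxx andbT; apply/forallP => -[].
rewrite enum_ordSl /= -map_comp.
pose Sol (x : {poly_N F}) := [set y : {ffun 'I_s -> {poly_N F}} |
  [forall i, y i \in A] &&
  (\sum_(i < s) c (lift ord0 i) * (y i : {poly F}) == e - c ord0 * (x : {poly F}))].
apply: (@leq_trans (\sum_(x in A) \sum_(y in Sol x) 1)%N).
  by apply: leq_sum => x _; rewrite sum1_card; exact: IHs.
pose phi (p : {poly_N F} * {ffun 'I_s -> {poly_N F}}) : {ffun 'I_s.+1 -> {poly_N F}} :=
  [ffun i => if unlift ord0 i is Some j then p.2 j else p.1].
have phi0 p : phi p ord0 = p.1 by rewrite ffunE unlift_none.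
have phiS p j : phi p (lift ord0 j) = p.2 j by rewrite ffunE liftK.
pose Y := [set p : {poly_N F} * {ffun 'I_s -> {poly_N F}} |
  (p.1 \in A) && (p.2 \in Sol p.1)].
rewrite (pair_big_dep (mem A) (fun x y => y \in Sol x) (fun _ _ => 1%N)) /=.
rewrite (eq_bigl (mem Y)) => [|p]; last by rewrite -[RHS]/(p \in Y) [RHS]finset.in_set.
rewrite -[leqRHS]sum1_card; apply: (@leq_sum_inj _ _ Y _ phi (fun=> 1%N)).
  move=> [x y] [x' y'] _ _ exy; congr (_, _).
    by have := phi0 (x, y); rewrite exy phi0.
  by apply/ffunP => j; have := phiS (x, y) j; rewrite exy phiS.
move=> [x y]; rewrite !inE /= => /and3P [xA /forallP yA /eqP sumy].
apply/andP; split.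
  by apply/forallP => i; case: (unliftP ord0 i) => [j ->|->]; rewrite ?phiS ?phi0.
rewrite big_ord_recl phi0 /=; under eq_bigr => j _ do rewrite phiS.
by rewrite /= sumy addrC subrK.
Qed.

Lemma Lambda_lower_bound (R : realType) (q l s : nat) : (1 < q)%N ->
  exists (kappa : R) (K : nat), 0 < kappa /\
    forall (F : finFieldType) (N : nat) (A : {set {poly_N F}}) (c : 'I_s.+1 -> {poly F}),
      #|F| = q -> (forall i, c i != 0) -> \sum_(i < s.+1) c i = 0 ->
      max_degree c = l -> kappa * density R A ^+ K.+1 <= Lambda R c A.
Proof.
move=> q_gt1; have [k [K [k_gt0 bound]]] := supersaturation R l s q_gt1.
exists k, K; split=> // F N A c Fq c_neq0 sum0 maxd.
have q_gt0 : 0 < q%:R :> R by rewrite ltr0n ltnW.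
rewrite /Lambda cardsT card_npoly Fq natrX -exprM [s.+1.-1]/= mulnC.
have qN_gt0 : 0 < q%:R ^+ N :> R by rewrite exprn_gt0.
rewrite ler_pdivlMr ?exprn_gt0 // -(ler_pM2r qN_gt0) -mulrA -exprD addnC -mulSn.
apply: le_trans (bound F N A [seq c i | i <- enum 'I_s.+1] Fq _ _ _) _.
- by rewrite size_map size_enum_ord.
- apply/allP => _ /mapP [i _ ->]; rewrite c_neq0 /=.
  have : ((size (c i)).-1 <= l)%N by rewrite -maxd; exact: (leq_bigmax i).
  by case: (size _).
- by rewrite big_map big_enum.
rewrite ler_pM2r // ler_nat; exact: count_solutions_le.
Qed.

(** The partition with the whole index set as its only block is zero-sum. *)
Lemma genus_gt0 (F : fieldType) (s : nat) (c : 'I_s.+1 -> {poly F}) :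
  \sum_(i < s.+1) c i = 0 -> (1 <= genus c)%N.
Proof.
move=> sum0; pose P : {set {set 'I_s.+1}} := [set [set: 'I_s.+1]%SET]%SET.
have P_ok : zero_sum_partition c P.
  apply/andP; split.
    apply/and3P; split; first by rewrite /finset.cover big_set1.
      apply/finset.trivIsetP => B1 B2; rewrite !inE => /eqP -> /eqP ->.
      by rewrite eqxx.
    rewrite inE eq_sym; apply/finset.set0Pn; exists ord0; exact: finset.in_setT.
  apply/forallP => B; apply/implyP; rewrite inE => /eqP ->.
  by apply/eqP; rewrite -[RHS]sum0; apply: eq_bigl => i; rewrite finset.in_setT.
apply: leq_trans (leq_bigmax_cond _ P_ok); by rewrite cards1.
Qed.

Theorem theorem5p2 (R : realType) (s q l : nat)
    (hs : (3 <= s)%N) (hq : prime_power q) :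
  exists2 C : R, 0 < C &
    forall (F : finFieldType) (c : 'I_s -> {poly F}),
      #|F| = q ->
      (forall i : 'I_s, c i != 0) ->
      \sum_(i < s) c i = 0 ->
      max_degree c = l ->
      (1 <= genus c)%N /\
      forall (N : nat) (A : {set {poly_N F}}),
        (0 < N)%N ->
        0 < density R A ->
        density R A < expR (- 2) ->
        expR (- (C * density R A `^ (- (1 / (s%:R - 2)))
                   * ln (1 / density R A) ^+ 4))
          <= Lambda R c A.
Proof.
have q_gt1 : (1 < q)%N.
  case: hq => p [k [p_prime k_gt0 ->]].
  apply: leq_trans (prime_gt1 p_prime) _; rewrite -{1}(expn1 p).
  by rewrite leq_exp2l // prime_gt1.
case: s hs => // s hs.
have [k [K [k_gt0 bound]]] := Lambda_lower_bound R l s q_gt1.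
(* With [L = ln (1 / alpha)] and [a = alpha^(-1/(s-2))], logarithms reduce the claim to
   [(K + 1) L - ln k <= C a L^4]. This [C] works because [a L^4] is at least [L] and at least 1. *)
exists (K.+1%:R + `|ln k|); first by rewrite ltr_wpDr // ltr0n.
move=> F c Fq c_neq0 sum0 maxd; split; first exact: genus_gt0.
move=> N A _ al_gt0 al_lt; apply: le_trans (bound F N A c Fq c_neq0 sum0 maxd).
move: (density R A) al_gt0 al_lt => al al_gt0 al_lt.
have kal_gt0 : 0 < k * al ^+ K.+1 by rewrite mulr_gt0 // exprn_gt0.
rewrite -[leRHS](lnK kal_gt0) ler_expR lnM ?posrE ?exprn_gt0 // lnXn //.
rewrite [1 / al]div1r lnV ?posrE // -[ln al *+ _]mulr_natl.
set L := - ln al.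
(* This is where [alpha < e^(-2)] enters. *)
have L_ge2 : 2 <= L.
  by rewrite lerNr -(expRK (-2)) ler_ln ?posrE ?expR_gt0 // ltW.
set a := al `^ _.
have a_ge1 : 1 <= a.
  have s_ge2 : 2 <= s.+1%:R :> R by rewrite (ler_nat R 2) ltnW.
  rewrite /a /powR gt_eqF // -[1 in leLHS]expR0 ler_expR mulNr -mulrN -/L.
  by apply: mulr_ge0; [rewrite divr_ge0 // subr_ge0|lra].
have L4 : L <= L ^+ 4 by rewrite -{1}[L]expr1 ler_weXn2l //; lra.
have lnk : - ln k <= `|ln k| by rewrite -normrN ler_norm.
have x_ge0 : 0 <= `|ln k| by [].
have K_ge0 : 0 <= K.+1%:R :> R by [].
have C_le : K.+1%:R * L + `|ln k| <= (K.+1%:R + `|ln k|) * a * L ^+ 4.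
  have aL : L <= a * L ^+ 4 by apply: (le_trans L4); rewrite ler_peMl //; lra.
  have aL1 : 1 <= a * L ^+ 4 by apply: le_trans aL; lra.
  rewrite -mulrA mulrDl; apply: lerD; first exact: ler_wpM2l.
  by rewrite ler_peMr.
have lnal : ln al = - L by rewrite opprK.
rewrite lnal; move: C_le; move: (_ * a * _) => u; lra.
Qed.
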